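(* Let $k \in \mathbb{N}$ and let $\rho : \mathbb{N}\to[0,\infty)$ be a function with $\sum_{m=1}^{\infty} \rho(m)/m < \infty$. Then for almost all $\theta>0$ (with respect to Lebesgue measure), the number of solutions to $$\left|\sum_{j=1}^{k} a_j^{\theta} - b\right| \leq \frac{\rho\left(\|(a_1, \dots, a_k)\|_{\infty}\right)}{\|(a_1, \dots, a_k)\|_{\infty}^{k}}$$ in the variables $\left((a_{j})_{j=1}^{k},b\right) \in \mathbb{N}^{k+1}$ is finite.
   Context: $\mathbb{N}=\{1,2,\ldots\}$. For $\mathbf{x}=(x_1,\ldots,x_k)\in\mathbb{R}^k$, $\|\mathbf{x}\|_\infty=\max_{1\le j\le k}|x_j|$. *)

(* Defs.v *)
From mathcomp Require Import all_boot all_order all_algebra.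
From mathcomp Require Import all_classical all_reals all_analysis.

Set Implicit Arguments.
Unset Strict Implicit.
Unset Printing Implicit Defensive.

Import Order.TTheory GRing.Theory Num.Theory.

Local Open Scope classical_set_scope.
Local Open Scope ring_scope.

(* Here |a_j| = a_j, so the sup norm of a vector of naturals is the natural
   number max_j a_j. *)
Definition supnorm (k : nat) (a : {ffun 'I_k -> nat}) : nat :=
  (\max_(j < k) a j)%N.

(* N = {1, 2, ...} throughout, hence the positivity conditions. *)
Definition solutions (R : realType) (k : nat) (rho : nat -> R) (theta : R) :
    set ({ffun 'I_k -> nat} * nat) :=
  [set ab : {ffun 'I_k -> nat} * nat |
    [/\ forall j : 'I_k, (0 < ab.1 j)%N,
        (0 < ab.2)%N &
        `| (\sum_(j < k) (ab.1 j)%:R `^ theta) - ab.2%:R |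
          <= rho (supnorm ab.1) / (supnorm ab.1)%:R ^+ k]].

Arguments solutions {R} k rho theta.

(* Main.v *)
Require Import Defs.
From mathcomp Require Import all_boot all_order all_algebra.
From mathcomp Require Import all_classical all_reals all_analysis.
From mathcomp Require Import ring lra.

Import Order.TTheory GRing.Theory Num.Theory.

Local Open Scope classical_set_scope.
Local Open Scope ring_scope.

(** Why the theorem holds.  Write f_a(t) for the sum of the a_j^t, let M be
the sup norm of a and delta = rho(M) / M^k.  The function f_a grows fast: its
increments are at least M^s ln M times the increments of t beyond s, while
f_a(s) is at most k M^s.  So wherever f_a is close to b, its slope is at least
of order b ln M / k, and the set of t where f_a is within delta of b has
diameter O(delta / (b ln M)) ([resonant_gap]).

For t in ]0, T] the relevant b are O(M^T).  Summing 1/b over them gives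
O(ln M), which exactly absorbs the denominator ln M: the set of t at which
f_a is within delta of some positive integer has measure O(delta), with a
constant that depends only on k and T ([resonant_coverable]).  There are at
most k M^(k-1) vectors of sup norm M, so all of them together account for a
set of measure O(rho(M) / M) ([near_integer_coverable]).  These bounds are
summable in M by hypothesis, and the Borel-Cantelli lemma shows that almost
every t in ]0, T] avoids the sets of all large M.  For such a t only
finitely many vectors a occur, each with finitely many b
([finite_solutions_supnorm_lt]).  Letting T run through the naturals
concludes.

Two points need care.  The diameter estimate uses delta <= 1/2, so that
b <= 2 f_a(s); this holds for all large M, because the terms rho(M) / M of a
convergent series tend to 0 and dominate delta.  It also uses M >= 2, so that
ln M is positive. *)

(** * Covering subsets of the line by small measurable sets *)

(** Bounding the measure of a measurable superset makes finite subadditivity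
available without proving that the exceptional sets are measurable. *)
Definition coverable {R : realType} (S : set R) (e : R) : Prop :=
  exists U : set R,
    [/\ measurable U, S `<=` U & (lebesgue_measure U <= e%:E)%E].

Lemma coverable_sub (R : realType) (S S' : set R) (e e' : R) :
  S' `<=` S -> e <= e' -> coverable S e -> coverable S' e'.
Proof.
move=> S'S ee' [U [mU SU Ue]]; exists U; split => //.
- exact: subset_trans SU.
- by rewrite (le_trans Ue)// lee_fin.
Qed.

Lemma coverable_bigcup_seq (R : realType) (I : eqType) (r : seq I)
    (S : I -> set R) (e : I -> R) :
  (forall i, i \in r -> coverable (S i) (e i)) ->
  coverable (\bigcup_(i in [set` r]) S i) (\sum_(i <- r) e i).
Proof.
elim: r => [_|i r IH Sr].
  exists set0; rewrite big_nil measure0; split => //.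
  by move=> x [i].
have [U [mU SU Ue]] := Sr i (mem_head _ _).
have [V [mV SV Ve]] := IH (fun j jr => Sr j (mem_behead (s := i :: r) jr)).
exists (U `|` V); split.
- exact: measurableU.
- move=> x [j /=]; rewrite inE => /orP[/eqP-> Sx|jr Sx].
    by left; exact: SU.
  by right; apply: SV; exists j.
- rewrite big_cons EFinD; apply: le_trans (leeD Ue Ve).
  exact: (measureU2 (@lebesgue_measure R)).
Qed.

(** A set of diameter at most e lies in the interval of length e that starts
at its infimum. *)
Lemma coverable_small_diameter (R : realType) (S : set R) (e : R) :
  0 <= e -> (forall x y, S x -> S y -> x <= y -> y - x <= e) ->
  coverable S e.
Proof.
move=> e0 Se; have [->|/set0P[x Sx]] := eqVneq S set0.
  by exists set0; rewrite measure0 lee_fin; split.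
have lbS : lbound S (x - e).
  move=> y Sy; have [xy|yx] := leP x y; first by lra.
  by have := Se _ _ Sy Sx (ltW yx); lra.
have hlb : has_lbound S by exists (x - e).
exists `[inf S, inf S + e]%classic; split.
- exact: measurable_itv.
- move=> y Sy; rewrite /= in_itv /= (ge_inf hlb Sy) /= -lerBlDr.
  apply: lb_le_inf; first by exists x.
  move=> z Sz; have [zy|yz] := leP z y; last by lra.
  by have := Se _ _ Sz Sy zy; lra.
- rewrite lebesgue_measure_itv /= lte_fin; case: ifP => _; rewrite lee_fin//.
  lra.
Qed.

(** * Growth of sums of powers *)

Lemma harmonic_le_ln (R : realType) (n : nat) :
  \sum_(b < n.+1) (b.+1%:R)^-1 <= 1 + ln (n.+1%:R : R).
Proof.
elim: n => [|n IH]; first by rewrite big_ord1 ln1 addr0 invr1.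
rewrite big_ord_recr /=.
have n1 : (0 : R) < n.+1%:R by rewrite ltr0n.
have n2 : (0 : R) < n.+2%:R by rewrite ltr0n.
(* The step from n to n + 1 is ln (1 - x) <= - x at x = 1 / (n + 2). *)
have quot : 1 + - (n.+2%:R)^-1 = n.+1%:R / n.+2%:R :> R.
  rewrite -[n.+2%:R]natr1; field.
  by move: n2; rewrite -natr1; lra.
have : ln (1 + - (n.+2%:R)^-1) <= - (n.+2%:R)^-1 :> R.
  apply: le_ln1Dx; rewrite ltrN2 invf_lt1// ltr1n//.
rewrite quot ln_div ?posrE//.
move: (n.+2%:R^-1) (ln _) (ln _) IH => x y z IH xyz.
by apply: le_trans (lerD IH (lexx _)) _; lra.
Qed.

(** The convex function t |-> x^t lies above its tangent at s; this avoids
differentiation and the mean value theorem. *)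
Lemma powR_increment (R : realType) (x s t : R) :
  0 < x -> x `^ s * (ln x * (t - s)) <= x `^ t - x `^ s.
Proof.
move=> x0; have -> : x `^ t = x `^ s * x `^ (t - s).
  by rewrite -powRD ?(gt_eqF x0) ?implybT//; congr (_ `^ _); lra.
rewrite -[X in _ <= _ - X]mulr1 -mulrBr ler_wpM2l ?powR_ge0//.
rewrite /(powR _ (t - s)) gt_eqF//.
have := expR_ge1Dx ((t - s) * ln x); lra.
Qed.

Definition powsum {R : realType} {k : nat} (a : {ffun 'I_k -> nat}) (t : R) :=
  \sum_(j < k) (a j)%:R `^ t.

Lemma powsum_le (R : realType) (k M : nat) (a : {ffun 'I_k -> nat}) (t : R) :
  0 <= t -> (forall j, (a j <= M)%N) -> powsum a t <= k%:R * M%:R `^ t.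
Proof.
move=> t0 aM; apply: (@le_trans _ _ (\sum_(j < k) (M%:R : R) `^ t)).
  by apply: ler_sum => j _; rewrite ge0_ler_powR ?nnegrE ?ler_nat.
by rewrite sumr_const card_ord mulr_natl.
Qed.

(** Every term is nondecreasing in the exponent, so one term alone bounds the
increment from below; it is applied to the largest entry. *)
Lemma powsum_increment (R : realType) (k : nat) (a : {ffun 'I_k -> nat})
    (j : 'I_k) (s t : R) :
  (forall i, (0 < a i)%N) -> s <= t ->
  (a j)%:R `^ s * (ln (a j)%:R * (t - s)) <= powsum a t - powsum a s.
Proof.
move=> a0 st; rewrite /powsum -sumrB (bigD1 j)//= -[leLHS]addr0 lerD//.
  by rewrite powR_increment// ltr0n.
by apply: sumr_ge0 => i _; rewrite subr_ge0 ler_powR// ler1n.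
Qed.

(** * Exponents for which a given vector comes close to an integer *)

Definition resonant {R : realType} {k : nat} (a : {ffun 'I_k -> nat})
    (T delta : R) (b : nat) : set R :=
  [set t | [/\ 0 < t, t <= T & `|powsum a t - b%:R| <= delta]].

(** Between s and t the sum of powers grows by at most 2 delta, and by at least
M^s ln M (t - s).  Since b <= 2 k M^s, the lower bound is at least
b ln M (t - s) / (2 k). *)
Lemma resonant_gap (R : realType) (k M b : nat) (a : {ffun 'I_k -> nat})
    (j : 'I_k) (T delta s t : R) :
  (1 < M)%N -> (forall i, (0 < a i <= M)%N) -> a j = M ->
  (0 < b)%N -> delta <= 2^-1 ->
  resonant a T delta b s -> resonant a T delta b t -> s <= t ->
  t - s <= 4 * k%:R * delta / ln M%:R * (b%:R)^-1.
Proof.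
move=> M1 aM ajM b0 d2 [s0 sT sd] [t0 tT td] st.
have a0 i : (0 < a i)%N by case/andP: (aM i).
have a_le i : (a i <= M)%N by case/andP: (aM i).
have lnM_gt0 : 0 < ln (M%:R : R) by rewrite ln_gt0// ltr1n.
have b1 : 1 <= (b%:R : R) by rewrite ler1n.
have fs := @powsum_le R k M a s (ltW s0) a_le.
have inc := @powsum_increment R k a j s t a0 st; rewrite ajM in inc.
move: sd td; rewrite !ler_distl => /andP[sd1 sd2] /andP[td1 td2].
(* b - 1/2 <= k M^s, and b - 1/2 >= b / 2 because b >= 1. *)
have bM : (b%:R : R) <= 2 * (k%:R * M%:R `^ s) by lra.
rewrite ler_pdivlMr; last lra.
rewrite ler_pdivlMr//.
have tsl : 0 <= (t - s) * ln (M%:R : R) by rewrite mulr_ge0 ?subr_ge0// ltW.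
have h1 : b%:R * ((t - s) * ln (M%:R : R)) <=
   2 * (k%:R * M%:R `^ s) * ((t - s) * ln (M%:R : R)) by rewrite ler_wpM2r.
have h2 : k%:R * (M%:R `^ s * (ln M%:R * (t - s))) <= k%:R * (2 * delta).
  by rewrite ler_wpM2l//; lra.
nra.
Qed.

(** The factor 4 k is that of [resonant_gap].  The harmonic sum up to
(k + 1) M^T is at most 1 + ln (k + 1) + T ln M, and the other factor bounds
its quotient by ln M for every M >= 2. *)
Definition cover_const {R : realType} (k : nat) (T : R) : R :=
  4 * k%:R * ((1 + ln k.+1%:R) / ln 2 + T).

Lemma cover_const_ge0 (R : realType) (k : nat) (T : R) :
  0 <= T -> 0 <= cover_const k T.
Proof.
move=> T0; rewrite /cover_const mulr_ge0// addr_ge0// divr_ge0//.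
  by rewrite addr_ge0// ln_ge0// ler1n.
by rewrite ln_ge0// ler1n.
Qed.

(** Adding up the diameters O(delta / (b ln M)) over all b = O(M^T) costs a
harmonic sum O(ln M), which cancels the ln M. *)
Lemma resonant_coverable (R : realType) (k M : nat) (a : {ffun 'I_k -> nat})
    (j : 'I_k) (T delta : R) :
  (1 < M)%N -> (forall i, (0 < a i <= M)%N) -> a j = M ->
  0 <= T -> 0 <= delta -> delta <= 2^-1 ->
  coverable (\bigcup_(b in [set b | (0 < b)%N]) resonant a T delta b)
    (cover_const k T * delta).
Proof.
move=> M1 aM ajM T0 d0 d2.
have a_le i : (a i <= M)%N by case/andP: (aM i).
have lnM_gt0 : 0 < ln (M%:R : R) by rewrite ln_gt0// ltr1n.
have ln2M : ln (2 : R) <= ln (M%:R : R).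
  by rewrite ler_ln ?posrE ?ltr0n// ?ler_nat// (ltn_trans _ M1).
have ln2 : 0 < ln (2 : R) by rewrite ln_gt0// ltr1n.
have MT1 : 1 <= (M%:R : R) `^ T.
  by rewrite -[leLHS](powRr0 M%:R) ler_powR// ler1n ltnW.
(* An integer within 1/2 of a real of ]0, k M^T] is at most N + 1. *)
pose N := Num.trunc (k%:R * (M%:R : R) `^ T).
have kMT0 : 0 <= k%:R * (M%:R : R) `^ T by rewrite mulr_ge0// powR_ge0.
have NkM : N.+1%:R <= k.+1%:R * (M%:R : R) `^ T.
  rewrite -!natr1 mulrDl mul1r lerD//.
  by rewrite /N truncn_le.
pose L : R := 4 * k%:R * delta / ln M%:R.
have L0 : 0 <= L by rewrite /L divr_ge0 ?mulr_ge0// ltW.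
apply: (@coverable_sub _ (\bigcup_(b in [set` index_enum 'I_N.+1])
    resonant a T delta b.+1) _ (\sum_(b < N.+1) L * (b.+1%:R)^-1)).
- move=> t [b /= b0 tb]; have [t0 tT] := tb; rewrite ler_distl => /andP[h1 h2].
  have bN : (b.-1 < N.+1)%N.
    rewrite prednK// -ltnS -(ltr_nat R).
    have ft := @powsum_le R k M a t (ltW t0) a_le.
    have ftT : k%:R * (M%:R : R) `^ t <= k%:R * M%:R `^ T.
      by rewrite ler_wpM2l// ler_powR// ler1n ltnW.
    have := truncnS_gt (k%:R * (M%:R : R) `^ T); rewrite -/N -[in N.+2%:R]natr1.
    by lra.
  exists (Ordinal bN); first by rewrite /= mem_index_enum.
  by rewrite /= prednK.
- rewrite -mulr_sumr.
  have := harmonic_le_ln R N.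
  have lnN : ln (N.+1%:R : R) <= ln k.+1%:R + T * ln M%:R.
    rewrite -ln_powR -lnM ?posrE ?powR_gt0 ?ltr0n//; last by rewrite ltnW.
    by rewrite ler_ln ?posrE ?mulr_gt0 ?powR_gt0 ?ltr0n// ltnW.
  move=> hN.
  apply: (@le_trans _ _ (L * (1 + ln k.+1%:R + T * ln M%:R))).
    by rewrite ler_wpM2l//; lra.
  have -> : L * (1 + ln k.+1%:R + T * ln M%:R) =
      4 * k%:R * delta * ((1 + ln k.+1%:R) / ln M%:R + T).
    by rewrite /L; move: (1 + _) (4 * _ * _) => A c; field; rewrite gt_eqF.
  rewrite /cover_const -[leRHS]mulrA [X in _ <= _ * X]mulrC mulrA.
  rewrite ler_wpM2l ?mulr_ge0// lerD2r ler_wpM2l//.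
    by rewrite addr_ge0// ln_ge0// ler1n.
  by rewrite lef_pV2 ?posrE.
- apply: coverable_bigcup_seq => b _; apply: coverable_small_diameter.
    by rewrite mulr_ge0.
  by move=> s t; apply: resonant_gap aM ajM _ d2.
Qed.

(** * Vectors of a given sup norm *)

Lemma card_ffun_fixed (k m : nat) (j : 'I_k) :
  #|[pred g : {ffun 'I_k -> 'I_m.+1} | g j == ord_max]| = (m.+1 ^ k.-1)%N.
Proof.
pose F (i : 'I_k) : pred 'I_m.+1 := if i == j then pred1 ord_max else predT.
rewrite (@eq_card _ _ (family F)); last first.
  move=> g; rewrite [LHS]inE; apply/idP/familyP => [gj i|/(_ j)].
    by rewrite /F; case: eqP => [->|_].
  by rewrite /F eqxx.
rewrite card_family foldrE big_map big_enum /= (bigD1 j)//=.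
rewrite {1}/F eqxx card1 mul1n.
rewrite (eq_bigr (fun=> m.+1)) => [|i /negPf ij]; last first.
  by rewrite /F ij card_ord.
by rewrite prod_nat_const (cardC1 j) card_ord.
Qed.

Lemma supnorm_attained {k : nat} (a : {ffun 'I_k -> nat}) :
  (0 < k)%N -> exists j, a j = supnorm a.
Proof.
move=> k0; rewrite /supnorm.
have [|j ->] := @bigop.eq_bigmax _ (fun j => a j); first by rewrite card_ord.
by exists j.
Qed.

Lemma le_supnorm {k : nat} (a : {ffun 'I_k -> nat}) (j : 'I_k) :
  (a j <= supnorm a)%N.
Proof. exact: leq_bigmax. Qed.

(** The shift parametrises the vectors with entries in 1, ..., m by a finite
type, so that they can be counted. *)
Definition succ_ffun {k m : nat} (g : {ffun 'I_k -> 'I_m}) :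
    {ffun 'I_k -> nat} :=
  [ffun j => (g j).+1].

Lemma succ_ffun_onto {k m : nat} (a : {ffun 'I_k -> nat}) :
  (forall j, (0 < a j <= m)%N) ->
  exists g : {ffun 'I_k -> 'I_m}, a = succ_ffun g.
Proof.
move=> am.
have am' j : ((a j).-1 < m)%N by case/andP: (am j) => a0; rewrite prednK.
exists [ffun j => Ordinal (am' j)]; apply/ffunP => j.
rewrite !ffunE /= prednK//.
by case/andP: (am j).
Qed.

(** * All vectors of a given sup norm together *)

Definition near_integer {R : realType} (k M : nat) (T delta : R) : set R :=
  [set t | exists (a : {ffun 'I_k -> nat}) (b : nat),
    [/\ forall j, (0 < a j)%N, supnorm a = M, (0 < b)%N &
        resonant a T delta b t]].

(** A vector of sup norm M has some entry equal to M and its other k - 1 entries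
in 1, ..., M: at most k M^(k-1) vectors, each contributing O(delta). *)
Lemma near_integer_coverable (R : realType) (k M : nat) (T delta : R) :
  (0 < k)%N -> (1 < M)%N -> 0 <= T -> 0 <= delta -> delta <= 2^-1 ->
  coverable (near_integer k M T delta)
    (k%:R * M%:R ^+ k.-1 * (cover_const k T * delta)).
Proof.
case: M => // m k0 M1 T0 d0 d2.
pose V (g : {ffun 'I_k -> 'I_m.+1}) : set R :=
  \bigcup_(b in [set b | (0 < b)%N]) resonant (succ_ffun g) T delta b.
pose r (j : 'I_k) := enum [pred g : {ffun 'I_k -> 'I_m.+1} | g j == ord_max].
apply: (@coverable_sub _ (\bigcup_(j in [set` index_enum 'I_k])
    \bigcup_(g in [set` r j]) V g) _
    (\sum_(j < k) \sum_(g <- r j) cover_const k T * delta)).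
- move=> t [a [b [a0 aM b0 tb]]].
  have [j aj] := supnorm_attained a k0; rewrite aM in aj.
  have [|g ag] := @succ_ffun_onto k m.+1 a.
    by move=> i; rewrite a0 -aM le_supnorm.
  exists j; first by rewrite /= mem_index_enum.
  exists g; last by exists b => //; rewrite -ag.
  rewrite /= mem_enum inE; apply/eqP/val_inj => /=.
  by move: aj; rewrite ag ffunE => -[].
- under eq_bigr do
    rewrite big_const_seq count_predT -cardE card_ffun_fixed iter_addr_0.
  by rewrite sumr_const card_ord -mulrnA -[leLHS]mulr_natl mulnC natrM natrX.
- apply: coverable_bigcup_seq => j _; apply: coverable_bigcup_seq => g.
  rewrite mem_enum inE => /eqP gj.
  apply: (@resonant_coverable _ _ m.+1 _ j) => //.
    by move=> i; rewrite ffunE /= ltn_ord.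
  by rewrite ffunE gj.
Qed.

(** * Finiteness and summability *)

(** For a fixed exponent, a vector a determines b up to the error
rho(M) / M^k, whatever its size, and there are finitely many vectors of
bounded sup norm. *)
Lemma finite_solutions_supnorm_lt (R : realType) (k n : nat) (rho : nat -> R)
    (t : R) :
  finite_set (solutions k rho t `&` [set ab | (supnorm ab.1 < n)%N]).
Proof.
pose A := [set g : {ffun 'I_k -> nat} | (supnorm g < n)%N].
have finA : finite_set A.
  case: n @A => [|n] A; first by rewrite (_ : A = set0)//; apply/seteqP; split.
  apply: (@sub_finite_set _ _
      ([set [ffun j => val (g j)] | g in [set: {ffun 'I_k -> 'I_n.+1}]]));
    last first.
    exact/finite_image/finite_finset.
  move=> a an; exists [ffun j => inord (a j)] => //; apply/ffunP => j.
  by rewrite !ffunE/= inordK// (leq_ltn_trans (le_supnorm a j)).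
pose B (a : {ffun 'I_k -> nat}) :=
  (Num.trunc (powsum a t + rho (supnorm a) / (supnorm a)%:R ^+ k)).+1.
apply: (@sub_finite_set _ _ (\bigcup_(a in A) ([set a] `*` `I_(B a))));
    last first.
  apply: bigcup_finite => // a _.
  by apply: finite_setX; [exact: finite_set1|exact: finite_II].
move=> [a b] [[/= a0 b0 hab] an]; exists a => //; split => //=.
move: hab; rewrite ler_distl => /andP[h _].
rewrite -(ltr_nat R); apply: le_lt_trans (truncnS_gt _).
by rewrite /powsum; lra.
Qed.

(** Each term is bounded by the tail of the series that starts with it. *)
Lemma nneseries_eventually_le (R : realType) (f : nat -> R) (e : R) :
  (forall n, 0 <= f n) -> (\sum_(0 <= n <oo) (f n)%:E < +oo)%E -> 0 < e ->
  exists N, forall n, (N <= n)%N -> f n <= e.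
Proof.
move=> f0 foo e0.
have fE0 n : xpredT n -> (0 <= (f n)%:E)%E by rewrite lee_fin.
have tail := nneseries_tail_cvg foo fE0.
have nbhs_lt_e : nbhs (0%E : \bar R) [set y | (y < e%:E)%E].
  by apply: open_ereal_lt'; rewrite lte_fin.
have [N _ HN] := tail _ nbhs_lt_e.
exists N => n /HN /= /ltW tn; rewrite -lee_fin; apply: le_trans tn.
rewrite (nneseries_split n 1) => [|i _]; last by rewrite lee_fin.
rewrite addn1 big_nat1 -[leLHS]adde0 leeD2l//.
by apply: nneseries_ge0 => i _ _; rewrite lee_fin.
Qed.

Theorem theorem1p5 (R : realType) (k : nat) (rho : nat -> R)
  (k_gt0 : (0 < k)%N)
  (rho_ge0 : forall m : nat, (0 < m)%N -> 0 <= rho m)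
  (rho_sum : (\sum_(1 <= m <oo) (rho m / m%:R)%:E < +oo)%E) :
  {ae @lebesgue_measure R, forall theta : R, 0 < theta ->
    finite_set (solutions k rho theta)}.
Proof.
(* Division by 0 yields 0, so f vanishes at 0 and can be summed from there. *)
pose f n : R := rho n / n%:R.
pose delta n : R := rho n / n%:R ^+ k.
have f_ge0 n : 0 <= f n.
  by case: n => [|n]; [rewrite /f invr0 mulr0|rewrite divr_ge0// rho_ge0].
have f_sum : (\sum_(0 <= n <oo) (f n)%:E < +oo)%E.
  rewrite nneseries_recl//; last by move=> n _; rewrite lee_fin.
  by rewrite {1}/f invr0 mulr0 add0e.
have delta_ge0 n : (0 < n)%N -> 0 <= delta n.
  by move=> n0; rewrite divr_ge0 ?rho_ge0// exprn_ge0.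
have delta_le n : (0 < n)%N -> delta n <= f n.
  move=> n0; rewrite ler_wpM2l ?rho_ge0// lef_pV2 ?posrE ?exprn_gt0 ?ltr0n//.
  by rewrite -[leLHS]expr1 ler_weXn2l// ler1n.
have [N HN] := nneseries_eventually_le R f 2^-1 f_ge0 f_sum ltac:(lra).
suff bounded (T : nat) : {ae @lebesgue_measure R, forall theta : R,
    0 < theta -> theta <= T%:R -> finite_set (solutions k rho theta)}.
  apply: filterS (ae_foralln bounded) => theta fin_theta theta0.
  apply: (fin_theta (Num.trunc theta).+1) => //.
  exact/ltW/truncnS_gt.
pose C : R := k%:R * cover_const k T%:R.
have C0 : 0 <= C by rewrite mulr_ge0// cover_const_ge0.
(* Where the covering bound is unavailable the empty set is chosen, so that
   the measures are summable over all n. *)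
have /choice[U HU] : forall n, exists U : set R, [/\ measurable U,
    (lebesgue_measure U <= C%:E * (f n)%:E)%E &
    (1 < n)%N -> delta n <= 2^-1 -> near_integer k n T%:R (delta n) `<=` U].
  move=> n; have [n1|] := ltnP 1 n; last first.
    by exists set0; split; rewrite // measure0 mule_ge0 ?lee_fin//.
  have [dn|] := leP (delta n) 2^-1; last first.
    by exists set0; split; rewrite // measure0 mule_ge0 ?lee_fin//.
  have n0 : (0 < n)%N := ltnW n1.
  have [U [mU nU Ue]] := near_integer_coverable R k n T%:R (delta n) k_gt0 n1
    (ler0n _ _) (delta_ge0 n n0) dn.
  exists U; split => //; apply: le_trans Ue _; rewrite -EFinM lee_fin.
  have -> : delta n = rho n / (n%:R * n%:R ^+ k.-1).
    by rewrite /delta -exprS prednK.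
  rewrite /C /f.
  rewrite le_eqVlt; apply/orP; left; apply/eqP.
  have n_neq0 : n%:R != 0 :> R by rewrite pnatr_eq0 -lt0n.
  by field; rewrite n_neq0 expf_neq0.
have mU n : measurable (U n) by case: (HU n).
(* The first Borel-Cantelli lemma. *)
have U0 : lebesgue_measure (lim_sup_set U) = 0.
  apply: lim_sup_set_cvg0 => //.
  apply: (@le_lt_trans _ _ (\sum_(0 <= n <oo) (C%:E * (f n)%:E))%E).
    apply: lee_nneseries => [n _ _|n _]; first exact: measure_ge0.
    by have [] := HU n.
  rewrite nneseriesZl; last by move=> n _; rewrite lee_fin.
  by rewrite lte_mul_pinfty ?lee_fin//.
exists (lim_sup_set U); split => //.
  apply: bigcap_measurable => [|n _]; first by exists 0%N.
  by apply: bigcup_measurable => i _; exact: mU.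
apply: subsetCl => theta /= notU theta0 thetaT.
have [m Hm] : exists m, forall n, (m <= n)%N -> ~ U n theta.
  apply: contrapT => /forallNP h; apply: notU => m _.
  have /existsNP[n /not_implyP[mn /contrapT Un]] := h m.
  by exists n.
apply: sub_finite_set
  (finite_solutions_supnorm_lt R k (maxn 2 (maxn m N)) rho theta).
move=> [a b] ab; split => //=; rewrite ltnNge; apply/negP.
rewrite !geq_max => /and3P[n1 mn Nn].
have [/= a0 b0 hab] := ab.
apply: (Hm _ mn); have [_ _] := HU (supnorm a); apply => //.
  by rewrite (le_trans (delta_le _ _) (HN _ Nn))// ltnW.
by exists a, b; split.
Qed.
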